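(* Let $P$ be a poset with least element $0$ and with $Z(P)^\times\neq\emptyset$, such that $|V(\Gamma_E(P))|<\infty$. Then for every vertex $[x]$ of maximal degree in $\Gamma_E(P)$, the ideal $\mathrm{ann}(x)$ is a maximal element (under inclusion) of $\mathfrak A=\{\mathrm{ann}(y)\mid y\in P^\times\}$, that is, $\mathrm{ann}(x)$ is an annihilator prime ideal of $P$.
   Context: For a poset $P$ with least element $0$ and $x,y\in P$: $L(x,y)=\{z\in P\mid z\le x,\ z\le y\}$, $\mathrm{ann}(x)=\{y\in P\mid L(x,y)=\{0\}\}$, $P^\times=P\setminus\{0\}$. An element $x\in P$ is a zero-divisor if $L(x,y)=\{0\}$ for some $y\in P^\times$; $Z(P)$ is the set of zero-divisors and $Z(P)^\times=Z(P)\setminus\{0\}$. An ideal of $P$ is a non-empty down-closed subset $I\subseteq P$ (no directedness is required). A prime ideal is an ideal $\mathfrak p\neq P$ such that for all $x,y\in P$, $L(x,y)\subseteq\mathfrak p$ implies $x\in\mathfrak p$ or $y\in\mathfrak p$. An annihilator prime ideal is a prime ideal of the form $\mathrm{ann}(x)$ with $x\in P$. Write $x\sim y$ if $\mathrm{ann}(x)=\mathrm{ann}(y)$, and $[x]$ for the class of $x$. $\Gamma_E(P)$ is the simple graph whose vertices are the classes $[x]$, $x\in Z(P)^\times$, with $[x]$ and $[y]$ adjacent iff $L(x,y)=\{0\}$ (this is well defined). The degree of a vertex is the number of vertices adjacent to it; a vertex has maximal degree if no vertex of the graph has larger degree. *)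

(* Defs.v *)
From mathcomp Require Import all_boot all_order.
From mathcomp Require Import finmap.
From mathcomp Require Import boolp classical_sets cardinality.
Set Implicit Arguments.
Unset Strict Implicit.
Unset Printing Implicit Defensive.
Import Order.Theory.
Local Open Scope classical_set_scope.
Local Open Scope order_scope.

Section ZeroDivisorGraph.
Variables (d : Order.disp_t) (P : bPOrderType d).
Implicit Types (x y z : P) (I : set P) (v w : set P).

Definition nonzero : set P := [set x | x <> \bot].

Definition lower x y : set P := [set z | z <= x /\ z <= y].

Definition ann x : set P := [set y | lower x y = [set \bot]].

Definition zero_divisor : set P :=
  [set x | exists2 y, nonzero y & lower x y = [set \bot]].

Definition nonzero_zero_divisor : set P := zero_divisor `&` nonzero.

(* Ideals are not required to be directed. *)
Definition ideal I : Prop :=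
  I !=set0 /\ forall x y, x <= y -> I y -> I x.

Definition prime_ideal I : Prop :=
  [/\ ideal I, I <> setT & forall x y, lower x y `<=` I -> I x \/ I y].

Definition annihilator_prime_ideal I : Prop :=
  prime_ideal I /\ exists x, I = ann x.

Definition annihilators : set (set P) := [set ann y | y in nonzero].

Definition maximal_annihilator I : Prop :=
  annihilators I /\ forall J, annihilators J -> I `<=` J -> J = I.

Definition ann_equiv x y : Prop := ann x = ann y.

Definition ann_class x : set P := [set y | ann_equiv x y].

(* The graph Gamma_E(P) lives on the type [set P]: its vertices are the classes
   of nonzero zero-divisors, and adjacency is only meaningful between them. *)
Definition gammaE_vertex : set (set P) :=
  [set ann_class x | x in nonzero_zero_divisor].

Definition gammaE_adj v w : Prop :=
  exists x y, [/\ v = ann_class x, w = ann_class y & lower x y = [set \bot]].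

Definition gammaE_neighbors v : set (set P) :=
  [set w | gammaE_vertex w /\ gammaE_adj v w].

(* [fset_set] is a junk value on infinite sets, so this is the degree only when
   [v] has finitely many neighbours, e.g. when [gammaE_vertex] is finite. *)
Definition gammaE_degree v : nat := #|` fset_set (gammaE_neighbors v)|%fset.

Definition gammaE_max_degree v : Prop :=
  gammaE_vertex v /\
  forall w, gammaE_vertex w -> (gammaE_degree w <= gammaE_degree v)%N.

Lemma lowerC x y : lower x y = lower y x.
Proof. by apply/seteqP; split=> z [? ?]; split. Qed.

Lemma ann_classE x y : (ann_class x = ann_class y) <-> (ann x = ann y).
Proof.
split=> [xy|xy]; last first.
  by apply/seteqP; split=> z; rewrite /ann_class /ann_equiv /= xy.
have : ann_class y y by [].
by rewrite -xy.
Qed.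

Lemma gammaE_adjE x y :
  gammaE_adj (ann_class x) (ann_class y) <-> lower x y = [set \bot].
Proof.
split=> [[a [b [/ann_classE xa /ann_classE yb ab]]]|xy]; last by exists x, y.
have : ann a b by [].
rewrite -xa => xb; have : ann b x by rewrite /ann /= lowerC.
by rewrite -yb /ann /= lowerC.
Qed.

Lemma gammaE_adj_sym v w : gammaE_adj v w -> gammaE_adj w v.
Proof. by move=> [x [y [-> -> xy]]]; exists y, x; rewrite lowerC. Qed.

Lemma gammaE_adj_irrefl v : gammaE_vertex v -> ~ gammaE_adj v v.
Proof.
move=> [x [_ x0] <-] /gammaE_adjE xx; apply: x0.
have : lower x x x by split.
by rewrite xx.
Qed.

End ZeroDivisorGraph.

Arguments nonzero_zero_divisor {d} P.
Arguments gammaE_vertex {d} P.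

(* Main.v *)
Require Import Defs.
From mathcomp Require Import all_boot all_order.
From mathcomp Require Import finmap.
From mathcomp Require Import boolp classical_sets cardinality.
Local Open Scope classical_set_scope.

(** If [ann x] is properly contained in [ann y] with [y] nonzero, then every
    neighbour of [[x]] is a neighbour of [[y]], and any [z] in [ann y] outside
    [ann x] gives a further neighbour of [[y]]; so the degree grows strictly, and
    a vertex of maximal degree has a maximal annihilator.  For primality, if
    [a] is not in [ann x], a nonzero [c] below both [a] and [x] has
    [ann x] contained in [ann c], hence [ann c = ann x] by maximality; and [c] is
    annihilated by every [b] with [lower a b] contained in [ann x]. *)

Section AnnihilatorPrimes.
#[local] Set Implicit Arguments.
#[local] Unset Strict Implicit.
Variables (d : Order.disp_t) (P : bPOrderType d).
Implicit Types x y z : P.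
Local Open Scope order_scope.
Import Order.Theory.

Lemma annP x y : ann x y <-> forall z, z <= x -> z <= y -> z = \bot.
Proof.
split=> [xy z zx zy|xy].
  have : lower x y z by split.
  by rewrite xy.
apply/seteqP; split=> z /=; first by case; exact: xy.
by move=> ->; split; exact: le0x.
Qed.

Lemma ann_sym x y : ann x y -> ann y x.
Proof. by rewrite /ann /= lowerC. Qed.

Lemma ann_bot x : ann x \bot.
Proof. by apply/annP => z _; rewrite lex0 => /eqP. Qed.

Lemma ann_irrefl x : nonzero x -> ~ ann x x.
Proof. by move=> x0 /annP/(_ x (lexx x) (lexx x)). Qed.

Lemma ann_nonzero x y : ~ ann x y -> nonzero y.
Proof. by move=> xy y0; apply: xy; rewrite y0; exact: ann_bot. Qed.

Lemma ann_anti x y : x <= y -> ann y `<=` ann x.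
Proof.
move=> xy z /annP yz; apply/annP => t tx tz.
by apply: yz => //; exact: le_trans xy.
Qed.

Lemma ann_ideal x : ideal (ann x).
Proof.
split; first by exists \bot; exact: ann_bot.
by move=> y z yz /ann_sym xz; apply/ann_sym/ann_anti/xz.
Qed.

Lemma maximal_annihilator_prime x :
  nonzero x -> maximal_annihilator (ann x) -> annihilator_prime_ideal (ann x).
Proof.
move=> x0 [_ xmax]; split; last by exists x.
split; first exact: ann_ideal.
  by move=> xT; apply: (ann_irrefl x0); rewrite xT.
move=> a b abx; apply: contrapT => /not_orP[xa xb].
apply: (xa); apply/annP => c cx ca; apply: contrapT => c0; apply: xb.
rewrite -(xmax (ann c)); [|by exists c|exact: ann_anti].
apply/annP => z zc zb.
(* A common lower bound [z] of [c] and [b] lies in [lower a b], hence in [ann x]; being also below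
   [x], it must be [\bot]. *)
have /annP xz : ann x z by apply: abx; split=> //; exact: le_trans ca.
by apply: xz => //; exact: le_trans cx.
Qed.

(** The class only supplies some nonzero [x'] with the same annihilator; if [x] were [\bot], that
    annihilator would be all of [P] and contain [x'] itself. *)
Lemma gammaE_vertex_nonzero x : gammaE_vertex P (ann_class x) -> nonzero x.
Proof.
case=> x' [_ x'0] /ann_classE xx' x0.
apply: (ann_irrefl x'0); rewrite xx' x0; exact/ann_sym/ann_bot.
Qed.

Lemma ann_gammaE_vertex x y :
  ann x y -> nonzero x -> nonzero y -> gammaE_vertex P (ann_class y).
Proof.
by move=> xy x0 y0; exists y => //; split=> //; exists x => //; exact: ann_sym.
Qed.

Lemma gammaE_neighbors_sub x y :
  ann x `<=` ann y ->
  gammaE_neighbors (ann_class x) `<=` gammaE_neighbors (ann_class y).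
Proof.
move=> xy _ [[z zP <-]] /gammaE_adjE xz; split; first by exists z.
exact/gammaE_adjE/xy.
Qed.

Lemma gammaE_degree_lt x y : finite_set (gammaE_vertex P) -> nonzero y ->
  ann x `<=` ann y -> ann y <> ann x ->
  (gammaE_degree (ann_class x) < gammaE_degree (ann_class y))%N.
Proof.
move=> finV y0 xy yx.
(* Finiteness makes [fset_set] faithful, so strict inclusion of neighbourhoods becomes strict
   inequality of degrees. *)
have finN v : finite_set (gammaE_neighbors (P := P) v).
  by apply: sub_finite_set finV => w [].
have [z yz xz] : exists2 z, ann y z & ~ ann x z.
  apply: contrapT => /forall2NP noz; apply: yx; apply/seteqP; split=> // z yz.
  by case: (noz z) => // /contrapT.
apply: fproper_ltn_card; rewrite fproperE; apply/andP; split.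
  by rewrite -fset_set_sub //; exact: gammaE_neighbors_sub.
apply/negP; rewrite -fset_set_sub // => /(_ (ann_class z)) yzx.
have [|_ /gammaE_adjE//] := yzx.
split; last exact/gammaE_adjE.
exact: ann_gammaE_vertex yz y0 (ann_nonzero xz).
Qed.

End AnnihilatorPrimes.

Theorem proposition4p8 (d : Order.disp_t) (P : bPOrderType d)
  (hZ : nonzero_zero_divisor P !=set0)
  (hfin : finite_set (gammaE_vertex P))
  (x : P) (hx : gammaE_max_degree (ann_class x)) :
  maximal_annihilator (ann x) /\ annihilator_prime_ideal (ann x).
Proof.
have [Vx degx] := hx; have x0 := gammaE_vertex_nonzero Vx.
suff xmax : maximal_annihilator (ann x).
  by split=> //; exact: maximal_annihilator_prime.
split=> [|_ [y y0 <-] xy]; first by exists x.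
apply: contrapT => yx.
(* Degrees are compared only between vertices, so [y] must be a zero-divisor: a nonzero [z]
   annihilating [x] also annihilates [y]. *)
have Vy : gammaE_vertex P (ann_class y).
  case: Vx => x' [[z z0 x'z] _] /ann_classE x'x.
  have yz : ann y z by apply: xy; rewrite -x'x.
  exact: ann_gammaE_vertex (ann_sym yz) z0 y0.
have := gammaE_degree_lt hfin y0 xy yx.
by rewrite ltnNge degx.
Qed.
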